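(* Let $p$ be a prime and $n\ge3$. The nilpotency index of the radical $\mathcal{R}(n,p)$ of the $p$-modular descent algebra $\Sigma(n,p)$ is $n-1$; that is, $\mathcal{R}(n,p)^{n-1}=0$ and $\mathcal{R}(n,p)^{n-2}\ne0$.
   Context: A composition of $n$ is a sequence of positive integers with sum $n$. The descent algebra $\Sigma_n$ has basis $\{B_q\}$ indexed by compositions of $n$ with multiplication $B_qB_r=\sum_{Z\in S(q,r)}B_{c(Z)}$, where for $q=[a_1,\dots,a_s]$, $r=[b_1,\dots,b_t]$, $S(q,r)$ is the set of $s\times t$ non-negative integer matrices with row sums $a_i$ and column sums $b_j$, and $c(Z)$ is the composition obtained by reading the entries of $Z$ row by row and omitting zeros. Let $\mathcal{Z}_n$ be the subring of integral combinations of the $B_q$ and $\Sigma(n,p)=\mathcal{Z}_n/p\mathcal{Z}_n$ (the $p$-modular descent algebra), an $\mathbb{F}_p$-algebra with basis $\overline{B}_q$ (images of $B_q$); $\mathcal{R}(n,p)$ denotes its (Jacobson) radical. The nilpotency index of a nilpotent ideal $\mathcal{R}$ is the least $k$ with $\mathcal{R}^k=0$. *)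

(* Defs.v *)
From HB Require Import structures.
From mathcomp Require Import all_boot all_order all_algebra.
Set Implicit Arguments. Unset Strict Implicit. Unset Printing Implicit Defensive.
Import GRing.Theory.
Local Open Scope ring_scope.

Definition is_comp (m : nat) (s : seq nat) : bool :=
  all (fun a => 0 < a)%N s && (sumn s == m).

Fixpoint comps_fuel (f m : nat) : seq (seq nat) :=
  match f with
  | 0 => if m == 0%N then [:: [::]] else [::]
  | f'.+1 => if m == 0%N then [:: [::]]
             else [seq k :: s | k <- iota 1 m, s <- comps_fuel f' (m - k)]
  end.

Definition comps (m : nat) : seq (seq nat) := comps_fuel m m.

Definition Comp (n : nat) : finType := seq_sub (comps n).

(* Structure constant: number of matrices Z in S(q,r) with c(Z) = w.
   Entries bounded by n suffice since the row sums are parts of q <= n. *)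
Definition reading (s t n : nat) (Z : {ffun 'I_s * 'I_t -> 'I_n.+1}) : seq nat :=
  [seq a <- [seq (val (Z (i, j))) | i <- enum 'I_s, j <- enum 'I_t] | a != 0%N].

Definition struct_const (n : nat) (q r w : seq nat) : nat :=
  #|[set Z : {ffun 'I_(size q) * 'I_(size r) -> 'I_n.+1} |
      [&& [forall i : 'I_(size q), (\sum_(j < size r) val (Z (i, j)))%N == nth 0%N q i],
          [forall j : 'I_(size r), (\sum_(i < size q) val (Z (i, j)))%N == nth 0%N r j]
        & reading Z == w]]|.

(* The p-modular descent algebra Sigma(n,p): coordinates on the basis B_q. *)
Definition Sig (n p : nat) : finType := {ffun Comp n -> 'F_p}.

Definition sig_mul (n p : nat) (x y : Sig n p) : Sig n p :=
  [ffun w : Comp n => \sum_(q : Comp n) \sum_(r : Comp n)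
      x q * y r * (struct_const n (val q) (val r) (val w))%:R].

(* Left ideals of Sigma(n,p) (as F_p-subspaces = additive subgroups). *)
Definition left_ideal (n p : nat) (I : {set Sig n p}) : bool :=
  [&& (0 : Sig n p) \in I,
      [forall x in I, forall y in I, x + y \in I]
    & [forall a : Sig n p, forall x in I, sig_mul a x \in I]].

Definition max_left_ideal (n p : nat) (I : {set Sig n p}) : bool :=
  [&& left_ideal I, I != setT &
      [forall J : {set Sig n p}, (left_ideal J && (I \subset J)) ==> ((J == I) || (J == setT))]].

Definition radical (n p : nat) : {set Sig n p} :=
  \bigcap_(I : {set Sig n p} | max_left_ideal I) I.

Definition sig_prod (n p : nat) (s : seq (Sig n p)) : Sig n p :=
  match s with
  | [::] => 0
  | x :: s' => foldl (@sig_mul n p) x s'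
  end.

Definition in_ideal_pow (n p : nat) (R : {set Sig n p}) (k : nat) (x : Sig n p) : Prop :=
  exists ss : seq (seq (Sig n p)),
    all (fun s => (size s == k) && all (fun y => y \in R) s) ss /\
    x = \sum_(s <- ss) sig_prod s.

Definition ideal_pow_zero (n p : nat) (R : {set Sig n p}) (k : nat) : Prop :=
  forall x, in_ideal_pow R k x -> x = 0.

(* Main.v *)
Require Import Defs.
From mathcomp Require Import all_boot all_order all_algebra fingroup perm.
Set Implicit Arguments. Unset Strict Implicit. Unset Printing Implicit Defensive.
Import GRing.Theory.

(** For a composition [q], let [theta q] send [B_r] to the number of maps from
    the parts of [q] to the parts of [r] whose fibres over each part [b] sum to
    [b].  This is multiplicative, so its kernel is a maximal left ideal, and the
    radical lies in the intersection [N] of these kernels.  Multiplying on the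
    right by an element of [N] raises by one the least length of a composition
    in the support: the part of [B_q x] of length [size q] is
    [theta q x * B_q].  Hence right multiplication by [N] is nilpotent, and a
    Nakayama argument gives that [N] is the radical.

    The length filtration starts at 2 on [N] and only yields exponent [n].  The
    missing step comes from the finer filtration by functionals that depend on
    [q] up to rearrangement: a product of two elements of [N] already lies in
    its fourth step, because in a two-row matrix with three nonzero entries
    the rows are distinguishable, so that swapping them pairs the matrices off.
    A product of [n - 1] elements of [N] is thus a multiple of [B_(1^n)] that
    the functional "sum of all coefficients" kills.

    Conversely, right multiplication by [B_(1,n-1) - B_(n-1,1)] acts on words as
    the derivation [a |-> [1, a - 1] - [a - 1, 1]], so the coefficient of
    [1^(n-2) 2] in its power [n - 2] is 1. *)

(** * Compositions of an integer *)

Lemma mem_comps m s : (s \in comps m) = is_comp m s.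
Proof.
(* The induction has to allow any fuel [f >= m]: after a first part [k] the remaining sum [m - k]
   may be well below the remaining fuel. *)
rewrite /comps; suff: forall f, m <= f -> (s \in comps_fuel f m) = is_comp m s by exact.
move=> f; elim: f m s => [|f IH] m s.
  rewrite leqn0 => /eqP -> /=; rewrite inE /is_comp.
  by case: s => [|[|a] s] //=; rewrite addSn andbF.
move=> le_mf /=; case: eqP => [->|/eqP m0].
  by rewrite inE /is_comp; case: s => [|[|a] s] //=; rewrite addSn andbF.
case: s => [|a s].
  rewrite /is_comp /= eq_sym (negbTE m0); apply/negP => /allpairsPdep [k [u [_ _]]].
  by [].
have -> : is_comp m (a :: s) = (0 < a <= m) && is_comp (m - a) s.
  rewrite /is_comp /=; case: (posnP a) => //= a0.
  case: (leqP a m) => [le_am|lt_ma] /=.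
    by rewrite -(eqn_add2l a (sumn s)) subnKC.
  apply/negP => /andP[_ /eqP E]; move: lt_ma; rewrite -E ltnNge leq_addr //.
apply/allpairsPdep/andP => [[k [u [kin uin [-> ->]]]]|[/andP[a0 am] su]].
  move: kin; rewrite mem_iota add1n ltnS => kin; split=> //.
  rewrite -IH //; case/andP: kin => k0 _.
  by rewrite leq_subLR; apply: leq_trans le_mf _; rewrite -addn1 addnC leq_add2r.
exists a, s; split=> //; first by rewrite mem_iota add1n ltnS a0.
by rewrite IH // leq_subLR; apply: leq_trans le_mf _; rewrite -addn1 addnC leq_add2r.
Qed.

Lemma comp_pos n (q : Comp n) : all (fun a => 0 < a) (val q).
Proof. by have := valP q; rewrite mem_comps => /andP[]. Qed.

Lemma comp_sum n (q : Comp n) : sumn (val q) = n.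
Proof. by have := valP q; rewrite mem_comps => /andP[_ /eqP]. Qed.

Lemma size_le_sumn (s : seq nat) : all (fun a => 0 < a) s -> size s <= sumn s.
Proof. by elim: s => //= a s IH /andP[a0 /IH]; rewrite -add1n; apply: leq_add. Qed.

Lemma comp_size n (q : Comp n) : size (val q) <= n.
Proof. by rewrite -[leqRHS](comp_sum q); apply/size_le_sumn/comp_pos. Qed.

Lemma sumn_nth (q : seq nat) : \sum_(i < size q) nth 0 q i = sumn q.
Proof. by rewrite sumnE (big_nth 0) big_mkord. Qed.

Lemma nth_pos (q : seq nat) (i : 'I_(size q)) : all (fun a => 0 < a) q -> 0 < nth 0 q i.
Proof. by move=> /all_nthP; apply. Qed.

(** * Matrices, their margins and their readings *)

Section Matrices.
Variables s t n : nat.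
Implicit Type Z : {ffun 'I_s * 'I_t -> 'I_n.+1}.

(** Margins are functions on [nat], and [s], [t] are tied to no sequence, so rows can be permuted
    without transport along equalities of sizes. *)
Definition margins (fq fr : nat -> nat) Z :=
  [forall i : 'I_s, \sum_(j < t) val (Z (i, j)) == fq i] &&
  [forall j : 'I_t, \sum_(i < s) val (Z (i, j)) == fr j].

Definition row_reading Z (i : 'I_s) : seq nat :=
  [seq a <- [seq val (Z (i, j)) | j <- enum 'I_t] | a != 0].

Lemma reading_rows Z : reading Z = flatten [seq row_reading Z i | i <- enum 'I_s].
Proof. by rewrite /reading filter_flatten -map_comp. Qed.

Lemma reading_cells Z :
  reading Z = [seq val (Z c) | c <-
     [seq c <- [seq (i, j) | i <- enum 'I_s, j <- enum 'I_t] | val (Z c) != 0]].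
Proof. by rewrite -(filter_map (fun c => val (Z c)) (fun a => a != 0)) map_allpairs. Qed.

Lemma sumn_filter0 (u : seq nat) : sumn [seq a <- u | a != 0] = sumn u.
Proof. by elim: u => //= -[|a] u /= ->. Qed.

Lemma sumn_row Z i : sumn (row_reading Z i) = \sum_(j < t) val (Z (i, j)).
Proof. by rewrite sumn_filter0 sumnE big_map big_enum. Qed.

Lemma size_row Z i : size (row_reading Z i) = #|[pred j | val (Z (i, j)) != 0]|.
Proof.
rewrite size_filter count_map cardE size_filter /enum_mem -enumT /=.
by rewrite count_filter; apply: eq_count => j; rewrite /= !inE andbT.
Qed.

Lemma size_reading Z : size (reading Z) = \sum_(i < s) size (row_reading Z i).
Proof.
by rewrite reading_rows size_flatten /shape -map_comp sumnE big_map big_enum.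
Qed.

Lemma reading_comp Z fq fr : margins fq fr Z ->
  \sum_(i < s) fq i = n -> is_comp n (reading Z).
Proof.
move=> /andP[/forallP rs _] sq; apply/andP; split.
  by apply/allP => a; rewrite mem_filter lt0n => /andP[].
rewrite reading_rows sumn_flatten -map_comp sumnE big_map big_enum /= -sq.
by apply/eqP; apply: eq_bigr => i _; rewrite sumn_row (eqP (rs i)).
Qed.

End Matrices.

(** * Maps with prescribed fibre sums *)

Definition fibred (q : seq nat) (I : finType) (r : I -> nat) :
    {set {ffun 'I_(size q) -> I}} :=
  [set f : {ffun 'I_(size q) -> I} | [forall j, \sum_(i | f i == j) nth 0 q i == r j]].

Lemma fibredP q (I : finType) (r : I -> nat) (f : {ffun 'I_(size q) -> I}) :
  reflect (forall j, \sum_(i | f i == j) nth 0 q i = r j) (f \in fibred q r).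
Proof. by rewrite inE; apply: (iffP forallP) => H j; apply/eqP; rewrite H. Qed.

Lemma eq_fibred q (I : finType) (r r' : I -> nat) :
  r =1 r' -> fibred q r = fibred q r'.
Proof. by move=> E; apply/setP => f; rewrite !inE; apply: eq_forallb => j; rewrite E. Qed.

(** Since the parts of [q] are positive, a fibre with sum 0 is empty. A counted map therefore takes
    values only where [r] is nonzero, and so factors through [h]. *)
Lemma card_fibred_inj q (I J : finType) (h : J -> I) (r : I -> nat) :
  all (fun a => 0 < a) q -> injective h ->
  (forall i, r i != 0 -> i \in codom h) ->
  #|fibred q r| = #|fibred q (r \o h)|.
Proof.
move=> q0 hI rh.
pose F (f : {ffun 'I_(size q) -> J}) : {ffun 'I_(size q) -> I} := [ffun i => h (f i)].
have FI : injective F.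
  move=> f g /ffunP E; apply/ffunP => i; apply: hI.
  by have := E i; rewrite !ffunE.
rewrite -(card_imset _ FI); apply: eq_card => f; apply/idP/imsetP.
  move=> /fibredP Hf.
  have fh i : f i \in codom h.
    apply: rh; rewrite -(Hf (f i)) -lt0n (bigD1 i) //= ltn_addr //.
    exact: nth_pos.
  exists [ffun i => iinv (fh i)].
    apply/fibredP => j; rewrite /= -(Hf (h j)); apply: eq_bigl => i.
    by rewrite ffunE -(inj_eq hI) f_iinv.
  by apply/ffunP => i; rewrite !ffunE f_iinv.
move=> [g /fibredP Hg ->]; apply/fibredP => j.
case: (boolP (j \in codom h)) => [/codomP [k ->]|jh].
  rewrite -[RHS](Hg k); apply: eq_bigl => i.
  by rewrite ffunE (inj_eq hI).
rewrite big_pred0; last first.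
  by move=> i; rewrite ffunE; apply: contraNF jh => /eqP <-; apply: codom_f.
by case: (altP (r j =P 0)) => // /rh; rewrite (negbTE jh).
Qed.

(** Positions of the reading embed into the cells of [Z] and hit every nonzero cell, so omitting
    zeros does not change the count. *)
Lemma card_fibred_reading q s t n (Z : {ffun 'I_s * 'I_t -> 'I_n.+1}) :
  all (fun a => 0 < a) q ->
  #|fibred q (fun j : 'I_(size (reading Z)) => nth 0 (reading Z) j)| =
  #|fibred q (fun c => val (Z c))|.
Proof.
move=> q0; rewrite reading_cells; set cells := [seq c <- _ | _].
pose h (k : 'I_(size [seq val (Z c) | c <- cells])) :=
  tnth (in_tuple cells) (cast_ord (size_map _ _) k).
have uc : uniq cells.
  apply/filter_uniq/allpairs_uniq; rewrite ?enum_uniq //.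
  by move=> [? ?] [? ?] _ _ [-> ->].
rewrite [RHS](@card_fibred_inj _ _ _ h) //.
- congr #|pred_of_set _|; apply: eq_fibred => k /=.
  rewrite /h (tnth_nth (tnth (in_tuple cells) (cast_ord (size_map _ _) k))) /=.
  by rewrite (nth_map (h k)) // -[ltnRHS](size_map (fun c => val (Z c))).
- move=> k l /eqP; rewrite /h !(tnth_nth (h k)) /= nth_uniq //.
  + by move=> /eqP /val_inj.
  + by rewrite -[ltnRHS](size_map (fun c => val (Z c))).
  + by rewrite -[ltnRHS](size_map (fun c => val (Z c))).
move=> c Zc; have cin : c \in cells.
  rewrite mem_filter Zc; apply/allpairsP; exists c.
  by rewrite !mem_enum; case: (c).
have lt : index c cells < size [seq val (Z c) | c <- cells].
  by rewrite size_map index_mem.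
apply/codomP; exists (Ordinal lt).
by rewrite /h (tnth_nth c) /= nth_index.
Qed.

(** * Pairs of maps and matrices of fibre sums *)

Section Multiplicative.
Variables (q : seq nat) (s t n : nat) (fr fs : nat -> nat).
Hypothesis q_sum : sumn q = n.
Implicit Types (Z : {ffun 'I_s * 'I_t -> 'I_n.+1})
  (f : {ffun 'I_(size q) -> 'I_s * 'I_t}).

Let weight f c := \sum_(i | f i == c) nth 0 q i.

Let weight_le f c : weight f c < n.+1.
Proof.
rewrite ltnS -q_sum -sumn_nth [leqRHS](bigID (fun i => f i == c)) /=.
exact: leq_addr.
Qed.

Let push f : {ffun 'I_s * 'I_t -> 'I_n.+1} := [ffun c => Ordinal (weight_le f c)].

Let mem_fibred_push f Z : (f \in fibred q (fun c => val (Z c))) = (Z == push f).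
Proof.
apply/fibredP/eqP => [H|-> j]; last by rewrite ffunE.
by apply/ffunP => c; rewrite ffunE; apply: val_inj; rewrite /= -H.
Qed.

Let fst_f f : {ffun 'I_(size q) -> 'I_s} := [ffun i => (f i).1].
Let snd_f f : {ffun 'I_(size q) -> 'I_t} := [ffun i => (f i).2].

Let margins_push f : margins fr fs (push f) =
  (fst_f f \in fibred q (fun i : 'I_s => fr i)) &&
  (snd_f f \in fibred q (fun j : 'I_t => fs j)).
Proof.
rewrite /margins !inE; congr (_ && _); apply: eq_forallb => a; congr (_ == _).
  rewrite [RHS](partition_big (fun i => (f i).2) xpredT) //=.
  apply: eq_bigr => b _; rewrite ffunE /=; apply: eq_bigl => i.
  by rewrite ffunE; case: (f i).
rewrite [RHS](partition_big (fun i => (f i).1) xpredT) //=.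
apply: eq_bigr => b _; rewrite ffunE /=; apply: eq_bigl => i.
by rewrite ffunE andbC; case: (f i).
Qed.

(* A map into pairs of indices is a pair of maps, and its fibre sums form the matrix [Z]. *)
Lemma sum_card_fibred :
  \sum_(Z : {ffun 'I_s * 'I_t -> 'I_n.+1} | margins fr fs Z) #|fibred q (fun c => val (Z c))| =
  #|fibred q (fun i : 'I_s => fr i)| * #|fibred q (fun j : 'I_t => fs j)|.
Proof.
under eq_bigr => Z _ do rewrite -sum1_card big_mkcond.
rewrite exchange_big /= -cardsX.
pose F f := (fst_f f, snd_f f).
have FI : injective F.
  move=> f g [/ffunP E1 /ffunP E2]; apply/ffunP => i.
  move: (E1 i) (E2 i); rewrite !ffunE.
  by case: (f i) (g i) => [? ?] [? ?] /= -> ->.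
transitivity (\sum_(f in [set f | margins fr fs (push f)]) 1).
  rewrite [RHS]big_mkcond; apply: eq_bigr => f _; rewrite inE.
  under eq_bigr => Z _ do rewrite mem_fibred_push.
  by rewrite -big_mkcondr big_mkcond (bigD1 (push f)) //= eqxx andbT big1 ?addn0 //
    => Z /negbTE ->; rewrite andbF.
rewrite sum1_card -(card_imset _ FI); apply: eq_card => -[g h].
rewrite inE /=; apply/imsetP/idP => [[f]|].
  by rewrite inE margins_push => H [-> ->].
pose f : {ffun 'I_(size q) -> 'I_s * 'I_t} := [ffun i => (g i, h i)].
have E1 : fst_f f = g by apply/ffunP => i; rewrite !ffunE.
have E2 : snd_f f = h by apply/ffunP => i; rewrite !ffunE.
by move=> H; exists f; [rewrite inE margins_push E1 E2|rewrite /F E1 E2].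
Qed.

End Multiplicative.

Lemma size1_sumn (u : seq nat) : size u = 1 -> u = [:: sumn u].
Proof. by case: u => [|a [|]] //= _; rewrite addn0. Qed.

(** * Matrices whose reading is as short as possible *)

Section Short.
Variables (q : seq nat) (t n : nat) (fr : nat -> nat).
Hypotheses (q_pos : all (fun a => 0 < a) q) (q_sum : sumn q = n).
Implicit Type Z : {ffun 'I_(size q) * 'I_t -> 'I_n.+1}.

Lemma row_size_gt0 Z i : margins (nth 0 q) fr Z -> 0 < size (row_reading Z i).
Proof.
move=> /andP[/forallP /(_ i) /eqP rs _]; rewrite lt0n size_eq0.
apply: contraTneq (nth_pos i q_pos) => E.
by rewrite -rs -sumn_row E.
Qed.

Lemma size_reading_ge Z : margins (nth 0 q) fr Z -> size q <= size (reading Z).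
Proof.
move=> mZ; rewrite size_reading -[leqLHS]card_ord -sum1_card.
by apply: leq_sum => i _; apply: row_size_gt0.
Qed.

Lemma rows_size1 Z i : margins (nth 0 q) fr Z -> size (reading Z) = size q ->
  size (row_reading Z i) = 1.
Proof.
move=> mZ; rewrite size_reading => /eqP.
rewrite -[X in _ == X]card_ord -sum1_card eq_sym.
(* Every row contributes at least 1, so equality of the sums forces equality in each row. *)
have := @leqif_sum _ xpredT (fun i => 1 == size (row_reading Z i)) (fun=> 1)
  (fun i => size (row_reading Z i)).
move=> /(_ (fun i _ => leqif_eq (row_size_gt0 i mZ))).
by move=> [_ ->] /forallP /(_ i) /eqP.
Qed.

Lemma reading_short Z : margins (nth 0 q) fr Z -> size (reading Z) = size q ->
  reading Z = q.
Proof.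
move=> mZ sz; have /andP[/forallP rs _] := mZ.
rewrite reading_rows (eq_map (g := fun i : 'I_(size q) => [:: nth 0 q i])).
  by rewrite flatten_map1 -[RHS](mkseq_nth 0) /mkseq -val_enum_ord -map_comp.
by move=> i; rewrite [LHS]size1_sumn ?rows_size1 // sumn_row (eqP (rs i)).
Qed.

Let nth_le (i : 'I_(size q)) : nth 0 q i < n.+1.
Proof. by rewrite ltnS -q_sum -sumn_nth (bigD1 i) //= leq_addr. Qed.

Let cells (f : {ffun 'I_(size q) -> 'I_t}) : {ffun 'I_(size q) * 'I_t -> 'I_n.+1} :=
  [ffun c => if f c.1 == c.2 then Ordinal (nth_le c.1) else ord0].

Let cellsE f i j : val (cells f (i, j)) = if f i == j then nth 0 q i else 0.
Proof. by rewrite ffunE /=; case: ifP. Qed.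

Let margins_cells f :
  margins (nth 0 q) fr (cells f) = (f \in fibred q (fun j : 'I_t => fr j)).
Proof.
rewrite inE /margins; have -> /= : [forall i : 'I_(size q),
    \sum_(j < t) val (cells f (i, j)) == nth 0 q i].
  apply/forallP => i; rewrite (bigD1 (f i)) //= cellsE eqxx.
  by rewrite big1 ?addn0 // => j jf; rewrite cellsE eq_sym (negbTE jf).
apply: eq_forallb => j; congr (_ == _); rewrite [RHS]big_mkcond.
by apply: eq_bigr => i _; rewrite cellsE.
Qed.

Let size_cells f : size (reading (cells f)) = size q.
Proof.
rewrite size_reading -[RHS]card_ord -sum1_card; apply: eq_bigr => i _.
rewrite size_row -(card1 (f i)); apply: eq_card => j; rewrite !inE cellsE [RHS]eq_sym.
by case: ifP => //= _; rewrite -lt0n nth_pos.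
Qed.

(** Such a matrix has exactly one nonzero entry in each row. It is determined by the map from rows
    to the columns of these entries, and its column sums are the fibre sums of that map. *)
Lemma card_short_matrices :
  #|[set Z : {ffun 'I_(size q) * 'I_t -> 'I_n.+1} |
      margins (nth 0 q) fr Z & size (reading Z) == size q]| =
  #|fibred q (fun j : 'I_t => fr j)|.
Proof.
have cI : injective cells.
  move=> f g E; apply/ffunP => i; apply/eqP.
  have := cellsE g i (f i); rewrite -E cellsE eqxx eq_sym.
  by case: ifP => // _ E0; have := nth_pos i q_pos; rewrite E0.
rewrite -(card_imset _ cI); apply: eq_card => Z; rewrite inE.
apply/andP/imsetP => [[mZ /eqP sz]|[f Hf ->]]; last first.
  by rewrite margins_cells size_cells.
have one i := rows_size1 i mZ sz.
have ex i : exists j, [pred j | val (Z (i, j)) != 0] =i pred1 j.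
  by apply/card1P; rewrite -size_row one.
have [x xP] := fin_all_exists ex.
pose f : {ffun 'I_(size q) -> 'I_t} := [ffun i => x i].
suff E : Z = cells f by exists f => //; rewrite -margins_cells -E.
apply/ffunP => -[i j]; apply: val_inj; rewrite cellsE ffunE.
have zE k : k != x i -> val (Z (i, k)) = 0.
  move=> /negbTE kx; have := xP i k; rewrite !inE kx.
  by move=> /negbFE /eqP.
case: eqVneq => [<-|/negPf xj]; last by rewrite zE // eq_sym xj.
have /andP[/forallP /(_ i) /eqP <- _] := mZ.
by rewrite [RHS](bigD1 (x i)) //= big1 ?addn0.
Qed.

End Short.

(** * Permuting the rows of a matrix *)

Section Permute.
Variables (s t n : nat).
Implicit Type Z : {ffun 'I_s * 'I_t -> 'I_n.+1}.

Definition permute_rows (u : {perm 'I_s}) Z : {ffun 'I_s * 'I_t -> 'I_n.+1} :=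
  [ffun c => Z (u c.1, c.2)].

Lemma permute_rows_inj u : injective (permute_rows u).
Proof.
move=> Z Y /ffunP E; apply/ffunP => -[i j].
by have := E ((u^-1)%g i, j); rewrite !ffunE /= permKV.
Qed.

Lemma row_permute u Z i : row_reading (permute_rows u Z) i = row_reading Z (u i).
Proof. by congr filter; apply: eq_map => j; rewrite ffunE. Qed.

Lemma perm_reading u Z : perm_eq (reading (permute_rows u Z)) (reading Z).
Proof.
rewrite !reading_rows (eq_map (row_permute u Z)) (map_comp (row_reading Z)).
apply/perm_flatten/perm_map; apply: uniq_perm.
- by rewrite map_inj_uniq ?enum_uniq //; apply: perm_inj.
- exact: enum_uniq.
move=> i; rewrite mem_enum; apply/mapP; exists ((u^-1)%g i); rewrite ?mem_enum ?permKV //.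
Qed.

Lemma margins_permute (u : {perm 'I_s}) (fq fq' fr : nat -> nat) Z :
  (forall i : 'I_s, fq' i = fq (u i)) ->
  margins fq' fr (permute_rows u Z) = margins fq fr Z.
Proof.
move=> E; congr (_ && _).
  apply/forallP/forallP => H i; apply/eqP.
    have := H ((u^-1)%g i); rewrite E permKV => /eqP <-.
    by apply: eq_bigr => j _; rewrite ffunE /= permKV.
  rewrite E -(eqP (H (u i))).
  by apply: eq_bigr => j _; rewrite ffunE.
apply: eq_forallb => j; congr (_ == _).
rewrite [RHS](reindex_inj (@perm_inj _ u)) /=.
by apply: eq_bigr => i _; rewrite ffunE.
Qed.

End Permute.

(** * Functionals evaluated on products of basis elements *)

Section Esum.
Variables (A : nzRingType) (n : nat).
Local Open Scope ring_scope.
Implicit Types (g : seq nat -> A) (q r : seq nat).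

(** For compositions [q] and [r] of [n], this is the value on [B_q B_r] of the linear functional
    that takes [B_w] to [g w]. *)
Definition esum g q r : A :=
  \sum_(Z : {ffun 'I_(size q) * 'I_(size r) -> 'I_n.+1} |
          margins (nth 0%N q) (nth 0%N r) Z) g (reading Z).

Definition perm_invariant g := forall v w, perm_eq v w -> g v = g w.

Definition theta q r : A := #|fibred q (fun j : 'I_(size r) => nth 0%N r j)|%:R.

Lemma eq_esum g g' q r : g =1 g' -> esum g q r = esum g' q r.
Proof. by move=> E; apply: eq_bigr => Z _; rewrite E. Qed.

Lemma esumD g g' q r : esum (fun v => g v + g' v) q r = esum g q r + esum g' q r.
Proof. exact: big_split. Qed.

(** Rearranging [q] permutes the rows of the matrices, which only rearranges their readings. *)
Lemma esum_perm g q q' r : perm_invariant g -> perm_eq q q' ->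
  esum g q r = esum g q' r.
Proof.
move=> gP qq'; rewrite /esum.
have sz := perm_size qq'.
(* Turning both sequences into functions on a common index range makes the two matrix types
   equal. *)
move: qq'; rewrite -{1}[q](mkseq_nth 0%N) -{1}[q'](mkseq_nth 0%N) -sz.
move: (nth 0%N q) (nth 0%N q') (size q) => fq fq' s /= E.
have [u uE] : exists u : {perm 'I_s}, forall i : 'I_s, fq' i = fq (u i).
  have : perm_eq [tuple fq' i | i < s] [tuple fq i | i < s].
    have mE (F : nat -> nat) : [tuple F i | i < s] = mkseq F s :> seq nat.
      by rewrite /mkseq -val_enum_ord -[RHS]map_comp.
    by rewrite perm_sym !mE.
  move=> /tuple_permP [u uE]; exists u => i.
  by have /(congr1 (fun v : s.-tuple nat => tnth v i)) := val_inj uE; rewrite !tnth_mktuple.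
rewrite [LHS](reindex_inj (@permute_rows_inj _ _ _ u^-1%g)) /=.
apply: eq_big => Z; last by move=> _; apply/gP/perm_reading.
by apply: margins_permute => i; rewrite uE permKV.
Qed.

(** Readings are at least as long as [q]. The longer ones are killed by [g], those of equal length
    are [q] itself, and [theta q r] counts the latter. *)
Lemma esum_short g q r : all (fun a => 0 < a)%N q -> sumn q = n ->
  (forall w, (size q < size w)%N -> g w = 0) -> esum g q r = g q * theta q r.
Proof.
move=> q0 qn g0; rewrite /theta -(card_short_matrices _ _ q0 qn) -sum1_card.
rewrite natr_sum mulr_sumr [RHS]big_mkcond [LHS]big_mkcond; apply: eq_bigr => Z _.
rewrite inE mulr1; case: ifP => //= mZ; case: eqP => [sz|/eqP sz].
  by rewrite (reading_short q0 mZ sz).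
by rewrite g0 // ltn_neqAle eq_sym sz (size_reading_ge q0 mZ).
Qed.

(** Maps from the parts of [v] to the parts of a reading amount to maps into the cells of the
    matrix; summed over all matrices, these are pairs of maps into [q] and [r]. *)
Lemma esum_theta v q r : all (fun a => 0 < a)%N v -> sumn v = n ->
  esum (theta v) q r = theta v q * theta v r.
Proof.
move=> v0 vn; rewrite -natrM -(@sum_card_fibred v _ _ n (nth 0%N q) (nth 0%N r) vn) natr_sum.
by apply: eq_bigr => Z _; rewrite /theta card_fibred_reading.
Qed.

(** A part of [r] is positive, hence has a nonempty fibre; a counted map would be surjective onto a
    larger set. *)
Lemma theta_size_gt q r : all (fun a => 0 < a)%N r -> (size q < size r)%N ->
  theta q r = 0.
Proof.
move=> r0 qr; rewrite /theta (_ : fibred _ _ = set0) ?cards0 //.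
apply/setP => f; rewrite in_set0; apply/negP => /fibredP fr.
have /subset_leq_card : [set: 'I_(size r)] \subset codom f.
  apply/subsetP => j _; have := fr j.
  case: (pickP (fun i => f i == j)) => [i /eqP <- _|fj]; first exact: codom_f.
  by rewrite big_pred0 // => rj; have := nth_pos j r0; rewrite -rj.
rewrite cardsT card_ord leqNgt; apply/negP/negPn.
by rewrite (leq_ltn_trans (leq_image_card _ _)) // card_ord.
Qed.

Let mem_fibred_two a b c d (f : {ffun 'I_2 -> 'I_2}) :
  (f \in fibred [:: a; b] (fun j : 'I_2 => nth 0%N [:: c; d] j)) =
  ((if f ord0 == ord0 then a else 0) +
     (if f (lift ord0 ord0) == ord0 then b else 0) == c)%N &&
  ((if f ord0 == ord0 then 0 else a) +
     (if f (lift ord0 ord0) == ord0 then 0 else b) == d)%N.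
Proof.
have n2 (x : 'I_2) : (x == lift ord0 ord0) = ~~ (x == ord0).
  by case: x => [[|[|]]].
have E j : (\sum_(i | f i == j) nth 0 [:: a; b] i =
    (if f ord0 == j then a else 0) + (if f (lift ord0 ord0) == j then b else 0))%N.
  by rewrite big_mkcond !big_ord_recl big_ord0 /= addn0.
rewrite inE; apply/forallP/andP => [H|[/eqP H0 /eqP H1] j].
  by have := H ord0; have := H (lift ord0 ord0); rewrite !E !n2 !if_neg.
rewrite E; have := n2 j; case: (altP (j =P ord0)) => [-> _|_ /eqP ->].
  by rewrite H0.
by rewrite !n2 !if_neg H1.
Qed.

(** A constant map would leave a positive part with an empty fibre, so only the identity and the
    swap remain. Both count when [a = b], which is why two indicators are added. *)
Lemma theta_two a b c d : (0 < a)%N -> (0 < b)%N -> (0 < c)%N -> (0 < d)%N ->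
  theta [:: a; b] [:: c; d] =
  ([:: c; d] == [:: a; b])%:R + ([:: c; d] == [:: b; a])%:R.
Proof.
move=> a0 b0 c0 d0; rewrite /theta.
pose f1 : {ffun 'I_2 -> 'I_2} := [ffun i => i].
pose f2 : {ffun 'I_2 -> 'I_2} := [ffun i => rev_ord i].
have E (f : {ffun 'I_2 -> 'I_2}) :
    ((f \in fibred [:: a; b] (fun j : 'I_2 => nth 0%N [:: c; d] j)) =
     (f == f1) && ([:: c; d] == [:: a; b]) || (f == f2) && ([:: c; d] == [:: b; a])).
  rewrite mem_fibred_two.
  have fE (h : {ffun 'I_2 -> 'I_2}) : (f == h) = 
      (f ord0 == h ord0) && (f (lift ord0 ord0) == h (lift ord0 ord0)).
    apply/eqP/andP => [->|[/eqP h0 /eqP h1]] //; apply/ffunP => i.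
    by case: (unliftP ord0 i) => [k ->|->] //; rewrite (ord1 k).
  rewrite !fE !ffunE !eqseq_cons eqxx !andbT.
  have n2 (x : 'I_2) : (x == lift ord0 ord0) = ~~ (x == ord0).
    by case: x => [[|[|]]].
  have -> : rev_ord ord0 = lift ord0 ord0 :> 'I_2 by apply: val_inj.
  have -> : rev_ord (lift ord0 ord0) = ord0 :> 'I_2 by apply: val_inj.
  rewrite !n2 (eq_sym c a) (eq_sym d b) (eq_sym c b) (eq_sym d a).
  case: (f ord0 == ord0); case: (f (lift ord0 ord0) == ord0); rewrite /= ?addn0 ?add0n ?orbF //.
  by rewrite (ltn_eqF d0) andbF.
  by rewrite (ltn_eqF c0).
have f12 : f1 != f2 by apply/eqP => /ffunP /(_ ord0); rewrite !ffunE.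
rewrite -sum1_card natr_sum big_mkcond (bigD1 f1) //= (bigD1 f2) ?[f2 == f1]eq_sym //= addrA.
rewrite big1 ?addr0 => [|f /andP[/negbTE ff1 /negbTE ff2]]; last by rewrite E ff1 ff2.
rewrite !E !eqxx [f2 == f1]eq_sym (negbTE f12) /= orbF.
by case: (_ == [:: a; b]); case: (_ == [:: b; a]).
Qed.

(* With an odd number of nonzero entries the two rows cannot have equally many, so
   swapping them exchanges the matrices counted here with the remaining ones. *)
Definition two_row_half g q r : A :=
  \sum_(Z : {ffun 'I_2 * 'I_(size r) -> 'I_n.+1} |
          margins (nth 0%N q) (nth 0%N r) Z &&
          (size (row_reading Z ord_max) < size (row_reading Z ord0))%N) g (reading Z).

(** Swapping the rows carries the matrices outside the first half to the second half, with row sums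
    exchanged; [g] does not notice, being invariant under rearrangement. *)
Lemma esum_two_rows g a b r : perm_invariant g -> (forall w, size w != 3 -> g w = 0) ->
  esum g [:: a; b] r = two_row_half g [:: a; b] r + two_row_half g [:: b; a] r.
Proof.
move=> gP g3; rewrite /esum (bigID (fun Z : {ffun 'I_2 * 'I_(size r) -> 'I_n.+1} =>
  (size (row_reading Z ord_max) < size (row_reading Z ord0))%N)) /=.
congr (_ + _); pose u : {perm 'I_2} := tperm ord0 ord_max.
rewrite [RHS](reindex_inj (@permute_rows_inj _ _ _ u)) /=.
rewrite [LHS]big_mkcond [RHS]big_mkcond; apply: eq_bigr => Z _.
rewrite !row_permute tpermL tpermR (@margins_permute _ _ _ u (nth 0%N [:: a; b])).
  rewrite (gP _ _ (perm_reading u Z)).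
  case: (altP (size (reading Z) =P 3)) => [|/g3 ->]; last by rewrite !if_same.
  rewrite size_reading !big_ord_recl big_ord0 addn0.
  have -> : lift ord0 ord0 = ord_max :> 'I_2 by apply: val_inj.
  by case: ltngtP => [||->] //; rewrite addnn => E; have := congr1 odd E; rewrite odd_double.
by case=> [[|[|]]] // H; rewrite permE /=.
Qed.
End Esum.

(** * Replacing one letter of a word *)

Lemma flatten_splice (u v : seq nat) i : i < size u ->
  flatten [seq if k == i then v else [:: nth 0 u k] | k <- iota 0 (size u)] =
  take i u ++ v ++ drop i.+1 u.
Proof.
move=> lt_i; have -> : size u = i + (1 + (size u - i.+1)).
  by rewrite add1n -subSn // subSS subnKC // ltnW.
rewrite !iotaD !map_cat !flatten_cat /= eqxx cats0 add0n addn1.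
congr (_ ++ (_ ++ _)).
  rewrite -(map_nth_iota0 0 (ltnW lt_i)) -[RHS]flatten_map1.
  by congr flatten; apply/eq_in_map => k; rewrite mem_iota => /andP[_ /ltn_eqF ->].
have := @map_nth_iota _ 0 u i.+1 (size u - i.+1).
rewrite take_oversize ?size_drop // => <- //; rewrite -[RHS]flatten_map1.
by congr flatten; apply/eq_in_map => k; rewrite mem_iota => /andP[/gtn_eqF ->].
Qed.

Definition nonzero (u : seq nat) := [seq a <- u | a != 0].

(** For a letter at most 2 the two replacements coincide. For a larger letter, the second one puts a
    letter above 1 before a 1, which the target word excludes, and the first one gives the target
    only from the word shown, at its last letter. *)
Lemma splice_eq (u : seq nat) i k m : all (fun a => 0 < a) u -> i < size u -> 1 < m ->
  (take i u ++ nonzero [:: 1; (nth 0 u i).-1] ++ drop i.+1 u == nseq k.+1 1 ++ [:: m]) =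
  (take i u ++ nonzero [:: (nth 0 u i).-1; 1] ++ drop i.+1 u == nseq k.+1 1 ++ [:: m])
    + ((u == nseq k 1 ++ [:: m.+1]) && (i == k)) :> nat.
Proof.
move=> u0 iu m1; have ui := all_nthP 0 u0 i iu.
have [le2|gt2] := leqP (nth 0 u i) 2.
  suff -> : (u == nseq k 1 ++ [:: m.+1]) && (i == k) = false.
    by rewrite addn0; case: (nth 0 u i) ui le2 => [|[|[|]]].
  apply/negP => /andP[/eqP uE /eqP ik]; move: le2; rewrite uE ik nth_cat size_nseq.
  by rewrite ltnn subnn /= ltnS leqNgt m1.
case E : (nth 0 u i) gt2 => [|[|[|a]]] // _ /=.
have nsE : 1 :: nseq k 1 ++ [:: m] = nseq k 1 ++ [:: 1; m].
  by elim: (k) => //= ? ->.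
have st : size (take i u) = i by rewrite size_take iu.
have nthw j : nth 0 (1 :: nseq k 1 ++ [:: m]) j =
    if j < k.+1 then 1 else if j == k.+1 then m else 0.
  rewrite -[1 :: _]/(nseq k.+1 1 ++ [:: m]) nth_cat size_nseq nth_nseq.
  by case: ltngtP => // [lt|->]; rewrite ?subnn // -subnSK //= ?nth_nil.
(* The letter [a.+2] at position [i] rules out the initial ones, so position [i.+1] lies past the
   end, where [nth] returns 0 and not 1. *)
have -> : (take i u ++ [:: a.+2, 1 & drop i.+1 u] == 1 :: nseq k 1 ++ [:: m]) = false.
  apply/negP => /eqP E2.
  have := congr1 (fun v => nth 0 v i) E2; have := congr1 (fun v => nth 0 v i.+1) E2.
  rewrite !nthw !nth_cat st ltnn ltnNge leqnSn subnn subSnn /=.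
  case: (ltnP i k.+1) => // ik.
  by rewrite ltnS ltnNge (ltnW ik) /= eqSS (gtn_eqF ik).
rewrite add0n; congr nat_of_bool; apply/eqP/andP => [E1|[/eqP uE /eqP ik]]; last first.
  have <- : m = a.+2.
    by move: E; rewrite ik uE nth_cat size_nseq ltnn subnn /= => -[].
  rewrite ik uE take_size_cat ?size_nseq // drop_oversize ?nsE //.
  by rewrite size_cat size_nseq addn1.
have ik : i = k.
  have := congr1 (fun v => nth 0 v i.+1) E1.
  by rewrite nthw nth_cat st ltnNge leqnSn subSnn /=; case: ltngtP => // -[].
have uE : u = take i u ++ a.+3 :: drop i.+1 u by rewrite -E -drop_nth ?cat_take_drop.
have : take i u ++ [:: 1, a.+2 & drop i.+1 u] = nseq k 1 ++ [:: 1; m].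
  by rewrite E1.
rewrite -ik eqxx => /eqP; rewrite eqseq_cat ?st ?size_nseq //.
by move=> /andP[/eqP tE /eqP [mE dE]]; rewrite uE tE dE mE.
Qed.

Lemma forall_ord2 (P : pred 'I_2) :
  [forall j, P j] = P ord0 && P (lift ord0 ord0).
Proof.
apply/forallP/andP => [H|[H0 H1] j]; first by split.
by case: (unliftP ord0 j) => [k ->|->] //; have -> : k = ord0 by apply: ord1.
Qed.

Lemma row_reading2 s n (Z : {ffun 'I_s * 'I_2 -> 'I_n.+1}) i :
  row_reading Z i = nonzero [:: val (Z (i, ord0)); val (Z (i, lift ord0 ord0))].
Proof.
congr filter; rewrite enum_ordSl enum_ordSl /=.
by rewrite (size0nil (size_enum_ord 0)).
Qed.

(** * Right multiplication by [[:: 1; m]] and [[:: m; 1]] *)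

Section Split.
Variables (A : nzRingType) (n m : nat) (u : seq nat).
Hypotheses (u0 : all (fun a => 0 < a) u) (un : sumn u = n) (nm : n = m.+1).

Definition split_mx (i : 'I_(size u)) : {ffun 'I_(size u) * 'I_2 -> 'I_n.+1} :=
  [ffun c => inord (if c.2 == ord0 then (c.1 == i : nat) else nth 0 u c.1 - (c.1 == i))].

Let nth_le (i : 'I_(size u)) : nth 0 u i <= n.
Proof. by rewrite -un -sumn_nth (bigD1 i) //= leq_addr. Qed.

Lemma split_mx0 i a : val (split_mx i (a, ord0)) = (a == i).
Proof. by rewrite ffunE /= inordK // nm; case: (_ == _). Qed.

Lemma split_mx1 i a : val (split_mx i (a, lift ord0 ord0)) = nth 0 u a - (a == i).
Proof. by rewrite ffunE /= inordK // ltnS (leq_trans (leq_subr _ _)). Qed.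

Let pos_eq (a i : 'I_(size u)) : (a == i) <= nth 0 u a.
Proof. by have := nth_pos a u0; case: (_ == _). Qed.

Lemma margins_split i : margins (nth 0 u) (nth 0 [:: 1; m]) (split_mx i).
Proof.
have s0 : \sum_(a < size u) val (split_mx i (a, ord0)) = 1.
  by under eq_bigr do rewrite split_mx0; rewrite (bigD1 i) //= eqxx big1 ?addn0 // => a /negbTE ->.
apply/andP; split; apply/forallP => a.
  by rewrite !big_ord_recl big_ord0 addn0 split_mx0 split_mx1 subnKC ?pos_eq.
case: (unliftP ord0 a) => [k ->|->]; last by rewrite s0.
have -> : k = ord0 by apply: ord1.
have mE : m = \sum_(a < size u) nth 0 u a - \sum_(a < size u) (a == i).
  rewrite sumn_nth un nm (bigD1 i) //= eqxx big1 ?addn0 ?subn1 // => b.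
  by move=> /negbTE ->.
rewrite /= [X in _ == X]mE -sumnB //.
by apply/eqP/eq_bigr => b _; rewrite split_mx1.
Qed.

(** A column with sum 1 is a unit vector, and the row sums then determine the other column. *)
Lemma split_surj Z : margins (nth 0 u) (nth 0 [:: 1; m]) Z -> exists i, Z = split_mx i.
Proof.
move=> /andP[/forallP rs /forallP /(_ ord0) /= /sum_nat_eq1 [i [_ i1 iz]]].
exists i; apply/ffunP => -[a j]; apply: val_inj.
have E a' : val (Z (a', ord0)) = (a' == i).
  by case: eqVneq => [->|/iz H]; [apply: i1|apply: H].
case: (unliftP ord0 j) => [k ->|->]; last by rewrite split_mx0 E.
have -> : k = ord0 by apply: ord1.
rewrite split_mx1 -E -(eqP (rs a)) !big_ord_recl big_ord0 addn0.
by rewrite addKn.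
Qed.

Lemma split_inj : injective split_mx.
Proof.
move=> i k E; apply/eqP; have := split_mx0 k i; rewrite -E split_mx0 eqxx.
by case: (i == k).
Qed.

Lemma sum_split (G : _ -> A) :
  (\sum_(Z | margins (nth 0%N u) (nth 0%N [:: 1%N; m]) Z) G Z = \sum_i G (split_mx i))%R.
Proof.
rewrite -[RHS](big_imset _ (in2W split_inj)) /=; apply: eq_bigl => Z.
by apply/idP/imsetP => [/split_surj [i ->]|[i _ ->]]; [exists i|apply: margins_split].
Qed.

Lemma reading_split i (Z : {ffun 'I_(size u) * 'I_2 -> 'I_n.+1}) :
  (forall a : 'I_(size u), a != i -> row_reading Z a = [:: nth 0 u a]) ->
  reading Z = take i u ++ row_reading Z i ++ drop i.+1 u.
Proof.
move=> Zr; rewrite -flatten_splice // reading_rows -val_enum_ord -[in RHS]map_comp.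
congr flatten; apply: eq_map => a /=; have -> : (val a == i) = (a == i) by [].
by case: eqVneq => [->|/Zr].
Qed.

(** Reduces the column sums [[:: m; 1]] to [[:: 1; m]], so that the matrices need to be classified
    only once. *)
Definition swap_columns s (Z : {ffun 'I_s * 'I_2 -> 'I_n.+1}) :
    {ffun 'I_s * 'I_2 -> 'I_n.+1} := [ffun c => Z (c.1, rev_ord c.2)].

Lemma swap_columnsK s : involutive (@swap_columns s).
Proof. by move=> Z; apply/ffunP => -[a j]; rewrite !ffunE /= rev_ordK. Qed.

Lemma margins_swap s fq (Z : {ffun 'I_s * 'I_2 -> 'I_n.+1}) a b :
  margins fq (nth 0 [:: a; b]) (swap_columns Z) = margins fq (nth 0 [:: b; a]) Z.
Proof.
congr (_ && _).
  apply: eq_forallb => i; congr (_ == _); rewrite [RHS](reindex_inj rev_ord_inj) /=.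
  by apply: eq_bigr => j _; rewrite ffunE.
rewrite !forall_ord2 andbC.
by congr (_ && _); congr (_ == _); apply: eq_bigr => i _; rewrite ffunE;
  congr (val (Z (_, _))); apply: val_inj.
Qed.

Lemma esum_split g : esum n g u [:: 1%N; m] =
  (\sum_(i < size u) (g (take i u ++ nonzero [:: 1%N; (nth 0%N u i).-1] ++ drop i.+1 u) : A))%R.
Proof.
rewrite /esum sum_split; apply: eq_bigr => i _; congr g.
rewrite (@reading_split i) => [|a ai]; rewrite row_reading2 split_mx0 split_mx1.
  by rewrite eqxx subn1.
rewrite (negbTE ai) /= subn0.
by have := nth_pos a u0; rewrite lt0n => ->.
Qed.

Lemma esum_split_swap g : esum n g u [:: m; 1%N] =
  (\sum_(i < size u) (g (take i u ++ nonzero [:: (nth 0%N u i).-1; 1%N] ++ drop i.+1 u) : A))%R.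
Proof.
rewrite /esum (reindex_inj (inv_inj (@swap_columnsK _))) /=.
rewrite (eq_bigl _ _ (fun Z => margins_swap _ Z _ _)) sum_split.
apply: eq_bigr => i _; congr g.
have E a : row_reading (swap_columns (split_mx i)) a =
    nonzero [:: nth 0 u a - (a == i); (a == i) : nat].
  rewrite row_reading2 -split_mx1 -split_mx0 !ffunE /=.
  by congr (nonzero [:: _; _]); congr (val (split_mx i (_, _))); apply: val_inj.
rewrite (@reading_split i) => [|a ai]; rewrite E.
  by rewrite eqxx subn1.
rewrite (negbTE ai) /= subn0.
by have := nth_pos a u0; rewrite lt0n => ->.
Qed.

(** The two sums over letters cancel term by term through [splice_eq], except at the last letter of
    the word on the right. The hypothesis [1 < l] keeps the two orders of splitting that letter
    distinct. *)
Lemma esum_commutator k l : (1 < l)%N ->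
  let g v := ((v == nseq k.+1 1%N ++ [:: l])%:R)%R in
  (esum n g u [:: 1%N; m] - esum n g u [:: m; 1%N] =
     (u == nseq k 1%N ++ [:: l.+1])%:R :> A)%R.
Proof.
move=> l1 g; rewrite esum_split esum_split_swap -GRing.sumrB.
transitivity (\sum_(i < size u) ((u == nseq k 1 ++ [:: l.+1]) && (val i == k))%:R : A)%R.
  by apply: eq_bigr => i _; rewrite /g splice_eq // natrD addrC addKr.
case: eqP => uE /=; last by rewrite big1.
have ku : k < size u by rewrite uE size_cat size_nseq addn1.
rewrite (bigD1 (Ordinal ku)) //= eqxx big1 ?addr0 // => i.
by rewrite -val_eqE /= => /negbTE ->.
Qed.

End Split.

(** * The right identity [[:: n]] *)

Section Unit.
Variables (A : nzRingType) (n : nat).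
Local Open Scope ring_scope.

Lemma theta_unit q : sumn q = n -> theta A q [:: n] = 1.
Proof.
move=> qn; rewrite /theta (_ : fibred _ _ = setT).
  by rewrite cardsT card_ffun !card_ord exp1n.
apply/setP => f; rewrite in_setT; apply/fibredP => j; rewrite (ord1 j) /= -qn -sumn_nth.
by apply: eq_bigl => i; rewrite (ord1 (f i)) eqxx.
Qed.

Lemma esum_unit (g : seq nat -> A) q : all (fun a => 0 < a)%N q -> sumn q = n ->
  esum n g q [:: n] = g q.
Proof.
(* With a single column no reading is longer than [q], so [g] may be cut off beyond that length to
   make [esum_short] applicable. *)
move=> q0 qn; pose h w := if (size w <= size q)%N then g w else 0.
transitivity (esum n h q [:: n]).
  apply: eq_bigr => Z _; rewrite /h size_reading.
  rewrite (leq_trans (leq_sum _ (fun i _ => _ : size (row_reading Z i) <= 1)%N)) //.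
    by move=> i _; rewrite size_row -[leqRHS](card_ord 1) max_card.
  by rewrite sum1_card card_ord.
rewrite esum_short // ?theta_unit ?mulr1 /h ?leqnn // => w.
by rewrite ltnNge => /negbTE ->.
Qed.

End Unit.

(** * The modular descent algebra through its linear functionals *)

Section Algebra.
Variables (n p : nat).
Local Open Scope ring_scope.
Notation K := ('F_p).
Implicit Types (g : seq nat -> K) (x y z : Sig n p).

Definition pairing g x : K := \sum_(w : Comp n) g (val w) * x w.

Lemma pairing_delta x w : pairing (fun v => (v == val w)%:R) x = x w.
Proof.
rewrite /pairing (bigD1 w) //= eqxx mul1r big1 ?addr0 // => v /negbTE vw.
by rewrite val_eqE vw mul0r.
Qed.

Lemma pairingD g x y : pairing g (x + y) = pairing g x + pairing g y.
Proof. by rewrite -big_split; apply: eq_bigr => w _; rewrite ffunE mulrDr. Qed.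

Lemma pairingB g x y : pairing g (x - y) = pairing g x - pairing g y.
Proof.
by apply/eqP; rewrite eq_sym subr_eq -pairingD subrK.
Qed.

Lemma pairingMn g x k : pairing g (x *+ k) = pairing g x *+ k.
Proof.
elim: k => [|k IH]; last by rewrite !mulrS pairingD IH.
by rewrite !mulr0n /pairing big1 // => w _; rewrite ffunE mulr0.
Qed.

Lemma eq_sig x y : (forall g, pairing g x = pairing g y) -> x = y.
Proof. by move=> E; apply/ffunP => w; rewrite -!pairing_delta E. Qed.

(** The reading of a matrix with these margins is a composition of [n], so it is matched by exactly
    one [w]. *)
Lemma esum_struct_const g (q r : Comp n) :
  \sum_(w : Comp n) g (val w) * (struct_const n (val q) (val r) (val w))%:R =
  esum n g (val q) (val r).
Proof.
have E w : (struct_const n (val q) (val r) w)%:R =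
    \sum_(Z : {ffun 'I_(size (val q)) * 'I_(size (val r)) -> 'I_n.+1} |
            margins (nth 0%N (val q)) (nth 0%N (val r)) Z) (reading Z == w)%:R :> K.
  rewrite /struct_const -sum1_card natr_sum big_mkcond [RHS]big_mkcond.
  apply: eq_bigr => Z _; rewrite inE andbA; case: ifP => [/andP[mZ ->]|].
    by rewrite /margins mZ.
  by rewrite -/(margins _ _ _); case: ifP => //= _ ->.
under eq_bigr => w _ do rewrite E mulr_sumr.
rewrite exchange_big; apply: eq_bigr => Z mZ.
have rZ : reading Z \in comps n.
  by rewrite mem_comps (reading_comp mZ) // sumn_nth comp_sum.
rewrite (bigD1 (SeqSub rZ)) //= eqxx mulr1 big1 ?addr0 // => w.
by rewrite -val_eqE /= eq_sym => /negbTE ->; rewrite mulr0.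
Qed.

Lemma pairing_mul g y x :
  pairing g (sig_mul y x) =
  \sum_(q : Comp n) y q * \sum_(r : Comp n) x r * esum n g (val q) (val r).
Proof.
rewrite /pairing; under eq_bigr => w _ do rewrite ffunE mulr_sumr.
rewrite exchange_big; apply: eq_bigr => q _.
under eq_bigr => w _ do rewrite mulr_sumr.
rewrite exchange_big mulr_sumr; apply: eq_bigr => r _ /=.
rewrite -esum_struct_const !mulr_sumr; apply: eq_bigr => w _.
by rewrite mulrC -!mulrA [_ * g _]mulrC.
Qed.

Lemma sig_mulDr y x z : sig_mul y (x + z) = sig_mul y x + sig_mul y z.
Proof.
apply: eq_sig => g; rewrite pairingD !pairing_mul -big_split; apply: eq_bigr => q _.
rewrite /= -mulrDr -big_split; congr (_ * _); apply: eq_bigr => r _.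
by rewrite ffunE mulrDl.
Qed.

(** Defined for every sequence, with value 0 when the sequence is not a composition of [n]; explicit
    sequences can thus be used without a membership proof. *)
Definition basis (q : seq nat) : Sig n p := [ffun w => (val w == q)%:R].

Lemma pairing_basis g (q : Comp n) : pairing g (basis (val q)) = g (val q).
Proof.
rewrite /pairing (bigD1 q) //= ffunE eqxx mulr1 big1 ?addr0 // => v /negbTE vw.
by rewrite ffunE val_eqE vw mulr0.
Qed.

Lemma pairing_mul_basis g y (r : Comp n) : pairing g (sig_mul y (basis (val r))) =
  \sum_(q : Comp n) y q * esum n g (val q) (val r).
Proof.
rewrite pairing_mul; apply: eq_bigr => q _; congr (_ * _).
rewrite -(pairing_basis (esum n g (val q))); apply: eq_bigr => w _.
by rewrite mulrC.
Qed.

(** * Kernels of the characters [theta] as maximal left ideals *)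

Definition theta_kernel (q : Comp n) : {set Sig n p} :=
  [set x | pairing (theta K (val q)) x == 0].

Lemma pairing_theta_mul (q : Comp n) y x : pairing (theta K (val q)) (sig_mul y x) =
  pairing (theta K (val q)) y * pairing (theta K (val q)) x.
Proof.
rewrite pairing_mul mulr_suml; apply: eq_bigr => v _; rewrite mulr_sumr mulr_sumr.
apply: eq_bigr => w _; rewrite esum_theta ?comp_pos ?comp_sum //.
by rewrite mulrA mulrACA [y v * _]mulrC [x w * _]mulrC.
Qed.

Definition in_kernels x := forall q : Comp n, pairing (theta K (val q)) x = 0.

Lemma in_kernels_mul y x : in_kernels x -> in_kernels (sig_mul y x).
Proof. by move=> xN q; rewrite pairing_theta_mul xN mulr0. Qed.

Hypothesis n0 : (0 < n)%N.

Lemma whole_comp : [:: n] \in comps n.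
Proof. by rewrite mem_comps /is_comp /= n0 addn0 eqxx. Qed.

Definition unit_comp : Comp n := SeqSub whole_comp.

Lemma sig_mul1 y : sig_mul y (basis [:: n]) = y.
Proof.
apply: eq_sig => g; rewrite (pairing_mul_basis g y unit_comp) /pairing.
by apply: eq_bigr => q _; rewrite esum_unit ?comp_pos ?comp_sum // mulrC.
Qed.

Lemma left_idealP (I : {set Sig n p}) :
  reflect [/\ 0 \in I, forall x y, x \in I -> y \in I -> x + y \in I
             & forall a x, x \in I -> sig_mul a x \in I] (left_ideal I).
Proof.
apply: (iffP and3P) => -[H0 HD HM]; split=> //.
- by move=> x y xI yI; move/forall_inP: HD => /(_ x xI) /forall_inP /(_ y yI).
- by move=> a x xI; move/forallP: HM => /(_ a) /forall_inP /(_ x xI).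
- by apply/forall_inP => x xI; apply/forall_inP => y; apply: HD.
- by apply/forallP => a; apply/forall_inP => x; apply: HM.
Qed.

Lemma max_left_idealP (I : {set Sig n p}) :
  reflect [/\ left_ideal I, I != setT
             & forall J : {set Sig n p}, left_ideal J -> I \subset J -> J = I \/ J = setT]
          (max_left_ideal I).
Proof.
apply: (iffP and3P) => -[HI HT H]; split=> //.
  move=> J JI IJ; move/forallP: H => /(_ J); rewrite JI IJ /=.
  by case/orP => /eqP; [left|right].
by apply/forallP => J; apply/implyP => /andP[JI IJ]; case: (H J JI IJ) => ->; rewrite eqxx ?orbT.
Qed.

(** The kernel of a nonzero functional to the prime field has codimension 1, so adding any outside
    element [z] gives everything. *)
Lemma theta_kernel_max q : max_left_ideal (theta_kernel q).
Proof.
have D x y : x \in theta_kernel q -> y \in theta_kernel q -> x + y \in theta_kernel q.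
  by rewrite !inE pairingD => /eqP -> /eqP ->; rewrite addr0.
apply/max_left_idealP; split.
- apply/left_idealP; split=> //.
    by rewrite inE -(mulr0n (0 : Sig n p)) pairingMn.
  by move=> a x; rewrite !inE pairing_theta_mul => /eqP ->; rewrite mulr0.
- apply/eqP => /setP /(_ (basis (val unit_comp))).
  by rewrite !inE pairing_basis theta_unit ?comp_sum // oner_eq0.
move=> J /left_idealP[J0 JD _] IJ; have [->|JI] := eqVneq J (theta_kernel q); first by left.
have [z zJ zI] : exists2 z, z \in J & z \notin theta_kernel q.
  by apply/subsetPn; apply: contraNN JI => JI; rewrite eqEsubset JI.
right; apply/setP => x; rewrite in_setT.
move: zI; rewrite inE; set c := pairing _ z => c0.
(* The scalar is read as a natural number, so that the multiple of [z] stays in [J] by closure under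
   addition. *)
pose k : nat := pairing (theta K (val q)) x / c.
have zk : z *+ k \in J by elim: (k) => [|l IH]; rewrite ?mulr0n ?mulrS ?JD.
rewrite -(subrK (z *+ k) x); apply: JD => //; apply: (subsetP IJ).
by rewrite inE pairingB pairingMn -/c -mulr_natr natr_Zp mulrC divfK ?subrr.
Qed.

Lemma radical_kernels x : x \in radical n p -> in_kernels x.
Proof.
move=> /bigcapP xR q; have := xR _ (theta_kernel_max q).
by rewrite inE => /eqP.
Qed.

(** * The length filtration and the radical *)

Definition long k x := forall w : Comp n, (size (val w) < k)%N -> x w = 0.

(** By [esum_short] the functional [g] takes [B_q x] to [g q] times the value of [theta q] at [x],
    which is 0. *)
Lemma sum_esum_short g (q : Comp n) x : in_kernels x ->
  (forall v, (size (val q) < size v)%N -> g v = 0) ->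
  \sum_(r : Comp n) x r * esum n g (val q) (val r) = 0.
Proof.
move=> xN gq; under eq_bigr => r _ do rewrite esum_short ?comp_pos ?comp_sum //.
transitivity (g (val q) * pairing (theta K (val q)) x); last by rewrite xN mulr0.
rewrite mulr_sumr; apply: eq_bigr => r _.
by rewrite mulrC mulrA.
Qed.

Lemma long_mul k y x : long k y -> in_kernels x -> long k.+1 (sig_mul y x).
Proof.
move=> yk xN w wk; rewrite -(pairing_delta _ w) pairing_mul big1 // => q _.
have [qk|kq] := ltnP (size (val q)) k; first by rewrite yk // mul0r.
rewrite sum_esum_short ?mulr0 // => v qv; case: eqP => // vw.
by move: qv; rewrite vw ltnNge (leq_trans _ kq).
Qed.

(** For a maximal left ideal [M], the set [J] is the left ideal [M + N]. Either it equals [M], which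
    then contains [x], or it contains [B_[n]], which forces [M] to be everything. *)
Lemma in_kernels_radical x : in_kernels x -> x \in radical n p.
Proof.
move=> xN; apply/bigcapP => M /max_left_idealP[/left_idealP[M0 MD MM] MT Mmax].
pose J : {set Sig n p} :=
  [set z : Sig n p | [exists y : Sig n p, (z - y \in M) && [forall q, y \in theta_kernel q]]].
have inJ (z y : Sig n p) : z - y \in M -> in_kernels y -> z \in J.
  move=> zy yN; rewrite inE; apply/existsP; exists y; rewrite zy /=.
  by apply/forallP => q; rewrite inE yN.
have outJ (z : Sig n p) : z \in J -> exists2 y, z - y \in M & in_kernels y.
  rewrite inE => /existsP[y /andP[zy /forallP yN]]; exists y => // q.
  by have := yN q; rewrite inE => /eqP.
have zN : in_kernels (0 : Sig n p).
  by move=> q; rewrite -(mulr0n (0 : Sig n p)) pairingMn.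
have JI : left_ideal J.
  apply/left_idealP; split; first by apply: inJ zN; rewrite subr0.
    move=> a b /outJ[y ay yN] /outJ[z bz z0]; apply: (@inJ _ (y + z)).
      by rewrite opprD addrACA MD.
    by move=> q; rewrite pairingD yN z0 addr0.
  move=> a z /outJ[y zy yN]; apply: (@inJ _ (sig_mul a y)); last exact: in_kernels_mul.
  suff -> : sig_mul a z - sig_mul a y = sig_mul a (z - y) by apply: MM.
  by apply/eqP; rewrite subr_eq -sig_mulDr subrK.
have MJ : M \subset J by apply/subsetP => z zM; apply: inJ zN; rewrite subr0.
have [JM|JT] := Mmax J JI MJ.
  by rewrite -JM; apply: inJ xN; rewrite subrr.
have [y y1 yN] : exists2 y, basis [:: n] - y \in M & in_kernels y.
  by apply: outJ; rewrite JT in_setT.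
(* Modulo [M], [b = b * 1] is [b * y]; iterating on the right needs no associativity
   and reaches 0. *)
case/eqP: MT; apply/setP => a; rewrite in_setT.
have down b : sig_mul b y \in M -> b \in M.
  move=> byM; rewrite -[b]sig_mul1 -[basis _](subrK y) sig_mulDr MD //.
  exact: MM.
pose b k := iter k (fun z => sig_mul z y) a.
have blong k : long k (b k) by elim: k => [|k IH] //; apply: long_mul.
(* The iteration starts at [long 0] and sizes go up to [n], hence [n.+1] steps. *)
have bn : b n.+1 = 0.
  by apply/ffunP => w; rewrite [RHS]ffunE blong // ltnS comp_size.
suff H k : b k \in M -> a \in M by apply: (H n.+1); rewrite bn.
by elim: k => // k IH /down.
Qed.

(** * The filtration by rearrangement-invariant functionals *)

Lemma long2 x : in_kernels x -> long 2 x.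
Proof.
move=> xN w w2; have := xN unit_comp.
have wE : val w = [:: n].
  have := comp_sum w; case: (val w) w2 => [|a [|//]] _ /=; first by move=> E; move: n0; rewrite -E.
  by rewrite addn0 => ->.
rewrite /pairing (bigD1 w) //= wE theta_unit /= ?addn0 // mul1r big1 ?addr0 // => v vw.
(* Every composition other than [[:: n]] has at least two parts, so [theta [:: n]] reads off the
   coefficient at [[:: n]] alone. *)
rewrite theta_size_gt ?comp_pos ?mul0r //=.
have := comp_sum v; move: vw; rewrite -val_eqE /= wE.
case: (val v) => [|a [|//]] //=; first by move=> _ E; move: n0; rewrite -E.
by rewrite addn0 => + E; rewrite E eqxx.
Qed.

(** Weaker than [long k]: among compositions with fewer than [k] parts, the coefficients only have
    to sum to 0 over each rearrangement class. *)
Definition symmetrically_long k x := forall g, perm_invariant g ->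
  pairing (fun v => if (size v < k)%N then g v else 0) x = 0.

Let cut k g v : K := if (size v < k)%N then g v else 0.

Let cut_invariant k g : perm_invariant g -> perm_invariant (cut k g).
Proof. by move=> gP v w vw; rewrite /cut (perm_size vw) (gP _ _ vw). Qed.

Let sum_esum_cut k g (q : Comp n) x : perm_invariant g -> in_kernels x -> (k <= size (val q))%N ->
  \sum_(r : Comp n) x r * esum n (cut k.+1 g) (val q) (val r) = 0.
Proof.
move=> gP xN kq; apply: sum_esum_short => // v; rewrite /cut ltnS => qv.
by rewrite leqNgt (leq_ltn_trans kq qv).
Qed.

(** As a function of [q], the value of the functional on [B_q x] is again invariant under
    rearrangement, and it vanishes once [q] has [k] parts; the hypothesis on [y] then applies to
    it. *)
Lemma symmetrically_long_mul k y x :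
  symmetrically_long k y -> in_kernels x -> symmetrically_long k.+1 (sig_mul y x).
Proof.
move=> yk xN g gP; rewrite -[X in pairing X]/(cut k.+1 g) pairing_mul.
pose G q := \sum_(r : Comp n) x r * esum n (cut k.+1 g) q (val r).
have GP : perm_invariant G.
  move=> v w vw; apply: eq_bigr => r _; congr (_ * _).
  exact: esum_perm (cut_invariant _ gP) vw.
rewrite -[RHS](yk G GP); apply: eq_bigr => q _; rewrite mulrC; congr (_ * _).
by case: ltnP => // kq; rewrite sum_esum_cut.
Qed.

Let theta_size2 (u v : seq nat) :
  all (fun a => 0 < a)%N u -> all (fun a => 0 < a)%N v -> size u == 2 -> size v == 2 ->
  theta K u v = (v == u)%:R + (v == rev u)%:R.
Proof.
case: u => [|a [|b [|]]] //; case: v => [|c [|d [|]]] //.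
by move=> /and3P[a0 b0 _] /and3P[c0 d0 _] _ _; apply: theta_two.
Qed.

Lemma symmetrically_long4 y x : in_kernels y -> in_kernels x ->
  symmetrically_long 4 (sig_mul y x).
Proof.
move=> yN xN g gP; rewrite -[X in pairing X]/(cut 4 g) pairing_mul.
pose g3 v : K := if size v == 3 then g v else 0.
have g3P : perm_invariant g3 by move=> v w vw; rewrite /g3 (perm_size vw) (gP _ _ vw).
have g3E v : cut 4 g v = cut 3 g v + g3 v.
  by rewrite /cut /g3 ltnS leq_eqVlt; case: ltngtP; rewrite /= ?addr0 ?add0r.
pose G q := \sum_(r : Comp n) x r * two_row_half n g3 q (val r).
have rev_comp (q : Comp n) : rev (val q) \in comps n.
  have := valP q; rewrite !mem_comps /is_comp all_rev sumn_rev //.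
pose R q : Comp n := SeqSub (rev_comp q).
have RK : involutive R by move=> q; apply: val_inj; rewrite /= revK.
(* Fewer than two parts are excluded by [long2], more than two by [sum_esum_cut]. For two parts only
   the readings of length 3 survive, and they split into the two halves. *)
transitivity (\sum_(q : Comp n | size (val q) == 2) y q * (G (val q) + G (rev (val q)))).
  rewrite [RHS]big_mkcond; apply: eq_bigr => q _; case: ifP => [q2|/negbT q2].
    have E4 (r : Comp n) : esum n (cut 4 g) (val q) (val r) =
        esum n (cut 3 g) (val q) (val r) + esum n g3 (val q) (val r).
      by rewrite -esumD; apply: eq_esum g3E.
    congr (_ * _); rewrite /G -big_split.
    under [LHS]eq_bigr => r _ do rewrite E4 mulrDr.
    rewrite [LHS]big_split /= sum_esum_cut ?(eqP q2) // add0r.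
    apply: eq_bigr => r _; rewrite -mulrDr; congr (_ * _).
    have : size (ssval q) == 2 := q2; case: (ssval q) => [|a [|b [|]]] // _.
    rewrite esum_two_rows //.
    by move=> v /negbTE v3; rewrite /g3 v3.
  have [q1|q3] := ltnP (size (val q)) 2; first by rewrite long2 // mul0r.
  by rewrite sum_esum_cut ?mulr0 // ltn_neqAle eq_sym q2.
(* For [q] of length 2 the sum [y q + y (rev q)] is [theta q] evaluated at [y]. *)
transitivity (\sum_(q : Comp n | size (val q) == 2) G (val q) * (y q + y (R q))).
  under eq_bigr => q _ do rewrite mulrDr [y q * G (val q)]mulrC.
  under [RHS]eq_bigr => q _ do rewrite mulrDr.
  rewrite !big_split; congr (_ + _); rewrite (reindex_inj (inv_inj RK)) /=.
  apply: eq_big => q; first by rewrite size_rev.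
  by rewrite revK mulrC.
apply: big1 => q q2; rewrite -[RHS](mulr0 (G (val q))); congr (_ * _); rewrite -[RHS](yN q).
rewrite /pairing (bigID (fun r : Comp n => size (val r) == 2)) /= addrC big1 ?add0r.
  have thetaE (i : Comp n) : size (val i) == 2 ->
      theta K (val q) (val i) = (i == q)%:R + (i == R q)%:R.
    by move=> i2; rewrite -!val_eqE; apply: theta_size2; rewrite ?comp_pos.
  have pick (v : Comp n) : size (val v) == 2 ->
      \sum_(i : Comp n | size (val i) == 2) (i == v)%:R * y i = y v.
    move=> v2; rewrite (bigD1 v) //= eqxx mul1r big1 ?addr0 // => i.
    by move=> /andP[_ /negbTE ->]; rewrite mul0r.
  under eq_bigr => i i2 do rewrite thetaE // mulrDl.
  by rewrite big_split /= !pick //= size_rev.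
move=> i; rewrite neq_ltn => /orP[i2|i2]; first by rewrite long2 ?mulr0.
by rewrite theta_size_gt ?comp_pos ?mul0r // (eqP q2).
Qed.

(** * Products of [n - 1] radical elements vanish *)

Lemma long_foldl k y s : long k y -> (forall x, x \in s -> in_kernels x) ->
  long (k + size s) (foldl (@sig_mul n p) y s).
Proof.
elim: s k y => [|x s IH] k y yk sN; first by rewrite addn0.
rewrite /= addnS -addSn; apply: IH => [|z zs]; last by apply: sN; rewrite inE zs orbT.
by apply: long_mul => //; apply: sN; rewrite mem_head.
Qed.

Lemma symmetrically_long_foldl k y s :
  symmetrically_long k y -> (forall x, x \in s -> in_kernels x) ->
  symmetrically_long (k + size s) (foldl (@sig_mul n p) y s).
Proof.
elim: s k y => [|x s IH] k y yk sN; first by rewrite addn0.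
rewrite /= addnS -addSn; apply: IH => [|z zs]; last by apply: sN; rewrite inE zs orbT.
by apply: symmetrically_long_mul => //; apply: sN; rewrite mem_head.
Qed.

Lemma comp_ones (w : Comp n) : (n <= size (val w))%N -> val w = nseq n 1%N.
Proof.
rewrite -[in X in nseq X](comp_sum w) -[leqLHS](comp_sum w); have := comp_pos w.
elim: (val w) => //= a s IH /andP[a0 s0] le.
have := size_le_sumn s0; have a1 : a = 1%N.
  apply/eqP; rewrite eqn_leq a0 andbT -(leq_add2r (sumn s)) (leq_trans le) //.
  by rewrite add1n ltnS size_le_sumn.
by rewrite a1 /= -IH //; move: le; rewrite a1 add1n.
Qed.

(** Only the composition into ones has [n] parts, and the constant functional 1 detects its
    coefficient. *)
Lemma long_symmetrically_long_eq0 y : long n y -> symmetrically_long n.+1 y -> y = 0.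
Proof.
move=> yn ys; apply/ffunP => w; rewrite [RHS]ffunE.
have [/yn //|nw] := ltnP (size (val w)) n.
have := ys (fun=> 1) (fun _ _ _ => erefl).
rewrite /pairing (bigD1 w) //= ltnS comp_size mul1r big1 ?addr0 // => v vw.
have [/yn ->|nv] := ltnP (size (val v)) n; first by rewrite mulr0.
by case/eqP: vw; apply: val_inj; rewrite (comp_ones nv) (comp_ones nw).
Qed.

(** The first two factors reach levels 3 and 4 of the two filtrations; the other [n - 3] raise these
    to [n] and [n.+1]. *)
Lemma sig_prod_eq0 s : (3 <= n)%N -> size s = (n - 1)%N ->
  (forall x, x \in s -> in_kernels x) -> sig_prod s = 0.
Proof.
move=> n3 sz; have : (2 <= size s)%N by rewrite sz ltn_subRL.
case: s sz => [|x1 [|x2 s]] //= sz _ sN; have x1N : in_kernels x1 by apply: sN; rewrite !inE eqxx.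
have x2N : in_kernels x2 by apply: sN; rewrite !inE eqxx orbT.
have sN' x : x \in s -> in_kernels x by move=> xs; apply: sN; rewrite !inE xs !orbT.
have nE : n = (3 + size s)%N by rewrite addSn add2n sz subn1 prednK.
apply: long_symmetrically_long_eq0; last first.
  have := symmetrically_long_foldl (symmetrically_long4 x1N x2N) sN'.
  by rewrite addSn -nE.
by have := long_foldl (long_mul (long2 x1N) x2N) sN'; rewrite -nE.
Qed.

(** * A nonzero product of [n - 2] radical elements *)

Lemma sig_mulBr y x z : sig_mul y (x - z) = sig_mul y x - sig_mul y z.
Proof. by apply/eqP; rewrite eq_sym subr_eq -sig_mulDr subrK. Qed.

Lemma theta_swap (q : Comp n) a b :
  theta K (val q) [:: a; b] = theta K (val q) [:: b; a].
Proof.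
rewrite /theta (@card_fibred_inj _ _ _ (@rev_ord 2) _ (comp_pos q) rev_ord_inj).
  congr (#|pred_of_set _|%:R); apply: eq_fibred => j /=.
  by case: (unliftP ord0 j) => [k ->|->] //; have -> : k = ord0 by apply: ord1.
by move=> i _; rewrite -(rev_ordK i) codom_f.
Qed.

(** The commutator of the letters [1] and [n.-1] under concatenation of words, not under
    [sig_mul]. *)
Definition commutator : Sig n p := basis [:: 1%N; n.-1] - basis [:: n.-1; 1%N].

Hypothesis n3 : (3 <= n)%N.

Let comp1n : [:: 1%N; n.-1] \in comps n.
Proof. by rewrite mem_comps /is_comp /= addn0 add1n prednK // eqxx -subn1 subn_gt0 (ltnW n3). Qed.

Let compn1 : [:: n.-1; 1%N] \in comps n.
Proof. by rewrite mem_comps /is_comp /= addn1 prednK // eqxx -subn1 subn_gt0 (ltnW n3). Qed.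

Lemma commutator_kernels : in_kernels commutator.
Proof.
move=> q; rewrite pairingB (pairing_basis _ (SeqSub comp1n)) (pairing_basis _ (SeqSub compn1)).
by rewrite /= theta_swap subrr.
Qed.

Definition hook_coef k y := pairing (fun v => (v == nseq k 1%N ++ [:: n - k]%N)%:R) y.

Lemma hook_coef_mul k y : (k.+1 <= n - 2)%N ->
  hook_coef k.+1 (sig_mul y commutator) = hook_coef k y.
Proof.
move=> kn; rewrite /hook_coef sig_mulBr pairingB.
rewrite (pairing_mul_basis _ _ (SeqSub comp1n)) (pairing_mul_basis _ _ (SeqSub compn1)).
rewrite -sumrB; apply: eq_bigr => q _; rewrite -mulrBr mulrC; congr (_ * _).
(* The bound on [k] keeps the last letter after splitting at least 2, as [esum_commutator]
   requires. *)
have l1 : (1 < n - k.+1)%N by move: kn; rewrite leq_subRL ?(ltnW n3) // ltn_subRL addn1.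
rewrite /= (esum_commutator _ (comp_pos q) (comp_sum q) _ _ l1) ?prednK //.
by rewrite subnSK // (leq_trans kn) ?leq_subr.
Qed.

Lemma hook_coef_foldl j k y : (k + j <= n - 2)%N ->
  hook_coef (k + j) (foldl (@sig_mul n p) y (nseq j commutator)) = hook_coef k y.
Proof.
elim: j k y => [|j IH] k y; first by rewrite addn0.
rewrite addnS -addSn => kj /=; rewrite IH // hook_coef_mul //.
by rewrite (leq_trans _ kj) // leq_addr.
Qed.

Lemma hook_coef_commutator : hook_coef 1 commutator = 1.
Proof.
rewrite /hook_coef pairingB (pairing_basis _ (SeqSub comp1n)) (pairing_basis _ (SeqSub compn1)).
(* As [n.-1] is at least 2, the second word of the commutator differs from the first and contributes
   nothing. *)
rewrite /= subn1 eqxx; case: (n) n3 => [|[|[|m]]] // _.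
by rewrite /= subr0.
Qed.

Lemma sig_prod_commutator : sig_prod (nseq (n - 2) commutator) != 0.
Proof.
(* The first factor already has its coefficient at [k = 1], so [n - 3] further factors lead to
   [k = n - 2]. *)
have -> : (n - 2 = (n - 3).+1)%N by rewrite subnSK.
apply/eqP => /= E; have := @hook_coef_foldl (n - 3) 1 commutator.
rewrite E hook_coef_commutator add1n subnSK // leqnn => /(_ isT).
rewrite /hook_coef -(mulr0n (0 : Sig n p)) pairingMn mulr0n => /eqP.
by rewrite eq_sym oner_eq0.
Qed.

End Algebra.

Theorem theorem3p4 (p n : nat) :
  prime p -> (3 <= n)%N ->
  ideal_pow_zero (radical n p) (n - 1) /\ ~ ideal_pow_zero (radical n p) (n - 2).
Proof.
move=> _ n3; have n0 : 0 < n by apply: leq_trans n3.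
split=> [x [ss [/allP ssR ->]]|H].
  rewrite big_seq big1 // => s /ssR /andP[/eqP sz /allP sR].
  by apply: sig_prod_eq0 => // y /sR; apply: radical_kernels.
case/eqP: (sig_prod_commutator p n0 n3); apply: H.
exists [:: nseq (n - 2) (commutator n p)]; rewrite big_seq1 /= size_nseq eqxx /=.
split=> //; rewrite andbT; apply/allP => x; rewrite mem_nseq => /andP[_ /eqP ->].
exact/in_kernels_radical/commutator_kernels.
Qed.
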